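(* Let $\mathcal{M}$ be a matroid on the ground set $\mathcal{G}=\{1,\dots,m\}$, let $X_m$ be the permutahedral toric variety and $\mathcal{E}_{\mathcal{M}}$ the tautological tropical vector bundle of $\mathcal{M}$ on $X_m$. Then for any character $u\in\mathbb{Z}^m$, $$\chi(X_m,\mathcal{E}_{\mathcal{M}})_u=h^0(X_m,\mathcal{E}_{\mathcal{M}})_u.$$
   Context: Write $\mathbf{e}_S=\sum_{i\in S}\mathbf{e}_i\in\mathbb{R}^m$ for $S\subseteq\mathcal{G}$, and $\operatorname{span}$ for matroid closure. Permutahedral fan. The permutahedral fan $\Sigma_m$ in $\mathbb{R}^m/\mathbb{R}\mathbf{e}_{\mathcal{G}}$ is the normal fan of the permutahedron $\operatorname{conv}\{\pi(1,\dots,m)\mid\pi\in S_m\}$; $X_m$ is its toric variety. The lifted fan $\widetilde{\Sigma_m}$ is the preimage of $\Sigma_m$ in $\mathbb{R}^m$; it encodes the action of the torus $(\mathbb{k}^* )^m$ on $X_m$, so characters are vectors $u\in\mathbb{Z}^m$. The cones $\sigma$ correspond bijectively to flags $\emptyset=S_0\subsetneq S_1\subsetneq\cdots\subsetneq S_l=\mathcal{G}$; the lifted cone is generated by $\mathbf{e}_{S_1},\dots,\mathbf{e}_{S_{l-1}},\mathbf{e}_{\mathcal{G}},-\mathbf{e}_{\mathcal{G}}$, and its codimension is $\operatorname{codim}(\sigma)=m-l$. The rays of $\Sigma_m$ correspond to the nonempty proper subsets $S\subsetneq\mathcal{G}$. Tautological bundle. $\mathcal{E}_{\mathcal{M}}$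 is the tropical vector bundle (with matroid $\mathcal{M}$) given by the piecewise linear map $\Phi_{\mathcal{M}}$ from $|\widetilde{\Sigma_m}|=\mathbb{R}^m$ to the lifted Bergman fan of $\mathcal{M}$, $\Phi_{\mathcal{M}}(w)_i=\sup\{k\in\mathbb{R}\mid i\in\operatorname{span}\{j\mid w_j\ge k\}\}$. Equivalently, it is given by the decreasing filtrations by flats $F^S_i$ ($i\in\mathbb{Z}$) for nonempty $S\subseteq\mathcal{G}$: $F^S_i=\mathcal{G}$ for $i\le0$, $F^S_1=\operatorname{span}(S)$, $F^S_i=\operatorname{span}(\emptyset)$ for $i\ge2$; and in the direction $-\mathbf{e}_{\mathcal{G}}$ by $\mathcal{G}$ for $i\le-1$ and $\operatorname{span}(\emptyset)$ for $i\ge0$. Sections and Euler characteristic. For $u\in\mathbb{Z}^m$ and a cone $\sigma$ with flag $S_1\subsetneq\cdots\subsetneq S_l=\mathcal{G}$: if $\sum_ju_j=1$, $H^0(U_\sigma,\mathcal{E}_{\mathcal{M}})_u=\bigcap_{k=1}^{l}F^{S_k}_{\langle u,\mathbf{e}_{S_k}\rangle}$ and $H^0(X_m,\mathcal{E}_{\mathcal{M}})_u=\bigcap_{\emptyset\ne S\subseteq\mathcal{G}}F^S_{\langle u,\mathbf{e}_S\rangle}$; if $\sum_ju_j\neq1$, the conditions in the directions $\pm\mathbf{e}_{\mathcal{G}}$ make both equal to $\operatorname{span}(\emptyset)$. Their matroid ranks are $h^0(U_\sigma,\mathcal{E}_{\mathcal{M}})_u$ and $h^0(X_m,\mathcal{E}_{\mathcal{M}})_u$,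 and $\chi(X_m,\mathcal{E}_{\mathcal{M}})_u=\sum_{\sigma\in\Sigma_m}(-1)^{\operatorname{codim}(\sigma)}h^0(U_\sigma,\mathcal{E}_{\mathcal{M}})_u$. *)

(* Defs.v *)
From HB Require Import structures.
From mathcomp Require Import all_boot all_order all_algebra.
From mathcomp Require Import reals constructive_ereal ereal.

Set Implicit Arguments.
Unset Strict Implicit.
Unset Printing Implicit Defensive.
Import Order.TTheory GRing.Theory Num.Theory.
Local Open Scope ring_scope.

Record matroid (T : finType) := Matroid {
  indep : {set {set T}};
  indep0 : set0 \in indep;
  indepS : forall A B : {set T}, A \subset B -> B \in indep -> A \in indep;
  indep_aug : forall A B : {set T}, A \in indep -> B \in indep ->
    (#|A| < #|B|)%N -> exists2 x, x \in B :\: A & x |: A \in indep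
}.

Definition mrank (T : finType) (M : matroid T) (A : {set T}) : nat :=
  \max_(I in indep M | I \subset A) #|I|.

Definition mspan (T : finType) (M : matroid T) (A : {set T}) : {set T} :=
  [set x | mrank M (x |: A) == mrank M A].

Definition evec (R : pzRingType) (m : nat) (S : {set 'I_m}) : 'rV[R]_m :=
  \row_i (i \in S)%:R.

Definition pairing (m : nat) (u v : 'rV[int]_m) : int :=
  \sum_i u 0 i * v 0 i.

(* A cone of the permutahedral fan, given by the set {S_1, ..., S_l} of nonzero
   members of its flag 0 = S_0 < S_1 < ... < S_l = [set: 'I_m]; the integer l
   is the cardinal of this set. *)
Definition flag (m : nat) (C : {set {set 'I_m}}) : bool :=
  [&& set0 \notin C, setT \in C &
      [forall A in C, forall B in C, (A \subset B) || (B \subset A)]].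

Definition codim (m : nat) (C : {set {set 'I_m}}) : nat := (m - #|C|)%N.

(* The filtration by flats of the tautological bundle along the ray spanned by
   [evec S], for S nonempty; see [filtE] for the comparison with [Phi]. *)
Definition filt (m : nat) (M : matroid 'I_m) (S : {set 'I_m}) (i : int) :
    {set 'I_m} :=
  if i <= 0 then setT else if i == 1 then mspan M S else mspan M set0.

(* The filtration in the direction - evec setT. *)
Definition filt_opp (m : nat) (M : matroid 'I_m) (i : int) : {set 'I_m} :=
  if i <= -1 then setT else mspan M set0.

(* The flat of degree u sections over the union of the lifted cones generated
   by - evec setT and by the vectors evec S, S in C. The conditions along
   evec setT and - evec setT produce the dichotomy on the sum of the
   coordinates of u, see [sections_sum1] and [sections_sum_neq1]. *)
Definition sections (m : nat) (M : matroid 'I_m) (C : {set {set 'I_m}})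
    (u : 'rV[int]_m) : {set 'I_m} :=
  filt_opp M (pairing u (- evec int setT)) :&:
  \bigcap_(S in C) filt M S (pairing u (evec int S)).

Definition h0_cone (m : nat) (M : matroid 'I_m) (C : {set {set 'I_m}})
    (u : 'rV[int]_m) : nat :=
  mrank M (sections M C u).

Definition h0 (m : nat) (M : matroid 'I_m) (u : 'rV[int]_m) : nat :=
  mrank M (sections M [set S | S != set0] u).

Definition euler_char (m : nat) (M : matroid 'I_m) (u : 'rV[int]_m) : int :=
  \sum_(C : {set {set 'I_m}} | flag C) (-1) ^+ codim C * (h0_cone M C u)%:Z.

(* The piecewise linear map defining the tautological bundle. Its values are
   extended reals because a loop has coordinate +oo. *)
Definition Phi (R : realType) (m : nat) (M : matroid 'I_m) (w : 'rV[R]_m)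
    (e : 'I_m) : \bar R :=
  ereal_sup (fun x : \bar R =>
    exists2 k : R, x = k%:E & e \in mspan M [set j | k <= w 0 j]).

Lemma mspanT (T : finType) (M : matroid T) : mspan M setT = setT.
Proof. by apply/setP => x; rewrite !inE setUT eqxx. Qed.

Lemma mrankS (T : finType) (M : matroid T) (A B : {set T}) :
  A \subset B -> (mrank M A <= mrank M B)%N.
Proof.
move=> sAB; apply/bigmax_leqP => I /andP[iI sIA].
by apply: leq_bigmax_cond; rewrite iI (subset_trans sIA).
Qed.

Lemma mspan0S (T : finType) (M : matroid T) (S : {set T}) :
  mspan M set0 \subset mspan M S.
Proof.
apply/subsetP => x; rewrite !inE setU0 => /eqP rx.
have r0 : mrank M set0 = 0%N.
  by apply/eqP; rewrite -leqn0; apply/bigmax_leqP => I /andP[_];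
    rewrite subset0 => /eqP->; rewrite cards0.
rewrite eqn_leq (mrankS M (subsetUr [set x] S)) andbT.
apply/bigmax_leqP => I /andP[iI sI].
apply: leq_bigmax_cond; rewrite iI /=.
have xI : x \notin I.
  apply/negP => xI; have: (#|[set x]| <= mrank M [set x])%N.
    by apply: leq_bigmax_cond; rewrite subxx (indepS _ iI) // sub1set.
  by rewrite rx r0 cards1.
apply/subsetP => y yI; have := subsetP sI y yI.
by rewrite !inE => /orP[/eqP yx|//]; rewrite -yx yI in xI.
Qed.

Lemma flag_card_leq (m : nat) (C : {set {set 'I_m}}) : flag C -> (#|C| <= m)%N.
Proof.
case/and3P => n0 _ /forall_inP ch.
have inj : {in C &, injective (fun A : {set 'I_m} => inord #|A| : 'I_m.+1)}.
  move=> A B AC BC /(congr1 val) /=.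
  have cb (D : {set 'I_m}) : (#|D| < m.+1)%N.
    by rewrite ltnS -[leqRHS]card_ord max_card.
  rewrite !inordK // => eqAB.
  by case/orP: (forall_inP (ch A AC) B BC) => s; [|symmetry];
    apply/eqP; rewrite eqEcard s eqAB leqnn.
rewrite -(card_in_imset inj) -ltnS.
rewrite -[ltnRHS]card_ord -cardsT; apply: proper_card; rewrite properEneq.
apply/andP; split; last by apply/subsetP => x; rewrite inE.
apply/negP => /eqP /setP /(_ ord0); rewrite inE => /imsetP[A AC].
move/(congr1 val); rewrite /= inordK; last first.
  by rewrite ltnS -[leqRHS]card_ord max_card.
by move=> /esym/cards0_eq A0; rewrite -A0 AC in n0.
Qed.

Lemma pairing_evec (m : nat) (u : 'rV[int]_m) (S : {set 'I_m}) :
  pairing u (evec int S) = \sum_(i in S) u 0 i.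
Proof.
rewrite /pairing [RHS]big_mkcond; apply: eq_bigr => i _ /=; rewrite mxE.
by case: (i \in S); rewrite ?mulr1 ?mulr0.
Qed.

Lemma pairing_oppT (m : nat) (u : 'rV[int]_m) :
  pairing u (- evec int setT) = - \sum_i u 0 i.
Proof.
rewrite /pairing -sumrN; apply: eq_bigr => i _.
by rewrite !mxE inE mulrN mulr1.
Qed.

Lemma sections_sum1 (m : nat) (M : matroid 'I_m) (C : {set {set 'I_m}})
    (u : 'rV[int]_m) : \sum_i u 0 i = 1 ->
  sections M C u = \bigcap_(S in C) filt M S (\sum_(i in S) u 0 i).
Proof.
move=> u1; rewrite /sections pairing_oppT u1 /filt_opp lexx setTI.
by apply: eq_bigr => S _; rewrite pairing_evec.
Qed.

Lemma sections_sum_neq1 (m : nat) (M : matroid 'I_m) (C : {set {set 'I_m}})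
    (u : 'rV[int]_m) : setT \in C -> \sum_i u 0 i != 1 ->
  sections M C u = mspan M set0.
Proof.
move=> TC u1; apply/eqP; rewrite eqEsubset; apply/andP; split; last first.
  rewrite subsetI; apply/andP; split.
    by rewrite /filt_opp; case: ifP; rewrite ?subsetT.
  apply/bigcapsP => S _; rewrite /filt.
  by case: ifP => _; [exact: subsetT | case: ifP => _; rewrite ?mspan0S].
have [gt1|le1] := ltP 1 (\sum_i u 0 i).
  apply: (subset_trans (subsetIr _ _)).
  apply: (subset_trans (bigcap_inf _ TC)).
  rewrite pairing_evec (eq_bigl xpredT) => [|i]; last by rewrite inE.
  by rewrite /filt (negPf u1) ifF // leNgt (lt_trans ltr01 gt1).
apply: (subset_trans (subsetIl _ _)).
rewrite pairing_oppT /filt_opp lerN2 ifF //.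
by apply/negbTE; rewrite -ltNge lt_neqAle u1.
Qed.

Lemma filtE (R : realType) (m : nat) (M : matroid 'I_m) (S : {set 'I_m})
    (i : int) : S != set0 ->
  filt M S i = [set e | ((i%:~R)%:E <= Phi M (evec R S) e)%E].
Proof.
move=> S0; apply/setP => e; rewrite inE /filt.
have le (k : R) : e \in mspan M [set j | k <= evec R S 0 j] ->
    (k%:E <= Phi M (evec R S) e)%E.
  by move=> ek; apply: ereal_sup_ubound; exists k.
have levT (k : R) : k <= 0 -> [set j | k <= evec R S 0 j] = setT.
  move=> k0; apply/setP => j; rewrite !inE mxE.
  by rewrite (le_trans k0) ?ler0n.
have levS (k : R) : 0 < k -> k <= 1 -> [set j | k <= evec R S 0 j] = S.
  move=> k0 k1; apply/setP => j; rewrite !inE mxE.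
  by case: (j \in S); rewrite ?k1 // leNgt k0.
have lev0 (k : R) : 1 < k -> [set j | k <= evec R S 0 j] = set0.
  move=> k1; apply/setP => j; rewrite !inE mxE; apply/negbTE.
  by rewrite -ltNge (le_lt_trans _ k1) // lern1 leq_b1.
case: ifPn => [i0|].
  by rewrite inE le // levT ?mspanT ?inE // -[0]/((0 : int)%:~R) ler_int.
rewrite -ltNge => i0; case: ifPn => [/eqP ->|i1].
  apply/idP/idP => [eS|]; first by rewrite le // levS ?ltr01.
  apply: contraTT => eS; rewrite -ltNge.
  apply: (@le_lt_trans _ _ 0%:E); last by rewrite lte_fin ltr01.
  apply: ge_ereal_sup => _ [k -> ek]; rewrite lee_fin leNgt.
  apply: contra eS => k0; have [k1|k1] := leP k 1.
    by rewrite levS // in ek.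
  by rewrite lev0 // in ek; exact: subsetP (mspan0S M S) e ek.
have {i0 i1} i1 : 1 < i by rewrite lt_neqAle eq_sym i1 -gtz0_ge1.
have i1R : (1 : R) < i%:~R by rewrite -[1]/((1 : int)%:~R) ltr_int.
apply/idP/idP => [e0|]; first by rewrite le // lev0.
apply: contraTT => e0; rewrite -ltNge.
apply: (@le_lt_trans _ _ 1%:E); last by rewrite lte_fin.
apply: ge_ereal_sup => _ [k -> ek]; rewrite lee_fin leNgt.
by apply: contra e0 => k1; rewrite lev0 in ek.
Qed.

Lemma filt_oppE (R : realType) (m : nat) (M : matroid 'I_m) (i : int) :
  filt_opp M i = [set e | ((i%:~R)%:E <= Phi M (- evec R setT) e)%E].
Proof.
apply/setP => e; rewrite inE /filt_opp.
have le (k : R) : e \in mspan M [set j | k <= (- evec R setT) 0 j] ->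
    (k%:E <= Phi M (- evec R setT) e)%E.
  by move=> ek; apply: ereal_sup_ubound; exists k.
have levT (k : R) : k <= -1 -> [set j | k <= (- evec R setT) 0 j] = setT.
  by move=> k1; apply/setP => j; rewrite !inE !mxE inE.
have lev0 (k : R) : -1 < k -> [set j | k <= (- evec R setT) 0 j] = set0.
  by move=> k1; apply/setP => j; rewrite !inE !mxE inE leNgt k1.
case: ifPn => [i1|].
  by rewrite inE le // levT ?mspanT ?inE // -[-1]/((-1 : int)%:~R) ler_int.
rewrite -ltNge => i1.
have i1R : (-1 : R) < i%:~R by rewrite -[-1]/((-1 : int)%:~R) ltr_int.
apply/idP/idP => [e0|]; first by rewrite le // lev0.
apply: contraTT => e0; rewrite -ltNge.
apply: (@le_lt_trans _ _ (-1)%:E); last by rewrite lte_fin.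
apply: ge_ereal_sup => _ [k -> ek]; rewrite lee_fin leNgt.
by apply: contra e0 => k1; rewrite lev0 in ek.
Qed.

(* Main.v *)
Require Import Defs.
From mathcomp Require Import all_boot all_order all_algebra zify.
Import Order.TTheory GRing.Theory Num.Theory.
Local Open Scope ring_scope.
Set Implicit Arguments.
Unset Strict Implicit.
Unset Printing Implicit Defensive.

(** Put [f(S) = \sum_(i in S) u_i] and let [N] be the set of [i] with
    [u_i <= 0]; only the case [f(setT) = 1] is not trivial.  On a chain [C]
    the sections form [mspan M S] for the least [S \in C] with [f(S) = 1], or
    [setT] if there is none, unless [f] exceeds 1 on [C] and the rank is 0.
    Let [E(S)] be the sum of
    [(-1)^|C|] times that rank over the chains [C] with largest member [S].
    Removing [S] from [C] gives a recursion over the proper subsets of [S],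
    whose solution is supported on the [S] such that [u_i <= 0] for all
    [i \in S] with at most one exception, where [u_i = 1]: toggling an element
    of [S :&: N] cancels the sum over the subsets of [S], and if [S] is
    disjoint from [N] and [f(S) = 1] then [S] is a singleton.  At [S = setT]
    only [u = e_i] survives and gives [mrank M [set i]]; this is [h0], because
    for every other [u] the set [~: N] has [f(~: N) >= 2]. *)

(** * Matroid rank and closure *)

Lemma mrank_indep (T : finType) (M : matroid T) (I S : {set T}) :
  I \in indep M -> I \subset S -> (#|I| <= mrank M S)%N.
Proof.
by move=> iI sI; apply: leq_bigmax_cond; rewrite iI.
Qed.

Lemma indep_extend (T : finType) (M : matroid T) (I S : {set T}) :
  I \in indep M -> I \subset S ->
  exists K, [/\ K \in indep M, I \subset K, K \subset S & #|K| = mrank M S].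
Proof.
pose P (K : {set T}) := [&& K \in indep M, I \subset K & K \subset S].
move=> iI sI; have PI : P I by rewrite /P iI subxx.
case: (arg_maxnP (fun K : {set T} => #|K|) PI) => K /and3P[iK sIK sKS] maxK.
exists K; split=> //; apply/eqP; rewrite eqn_leq mrank_indep //=.
apply/bigmax_leqP => J /andP[iJ sJ]; rewrite leqNgt; apply/negP => ltKJ.
have [x] := indep_aug iK iJ ltKJ; rewrite inE => /andP[xK xJ] ixK.
have : P (x |: K).
  by rewrite /P ixK subUset sub1set (subsetP sJ) // sKS subsetU // sIK orbT.
by move/maxK => /=; rewrite cardsU1 xK add1n leqNgt ltnSn.
Qed.

Lemma mrank_basis (T : finType) (M : matroid T) (S : {set T}) :
  exists I, [/\ I \in indep M, I \subset S & #|I| = mrank M S].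
Proof.
have [K [iK _ sK cK]] := indep_extend (indep0 M) (sub0set S).
by exists K.
Qed.

Lemma mrank0 (T : finType) (M : matroid T) : mrank M set0 = 0%N.
Proof.
have [I [_ + <-]] := mrank_basis M set0.
by rewrite subset0 => /eqP ->; rewrite cards0.
Qed.

Lemma notin_mspan_basis (T : finType) (M : matroid T) (S I : {set T}) (x : T) :
  I \subset S -> #|I| = mrank M S -> x \notin I -> x |: I \in indep M ->
  x \notin mspan M S.
Proof.
move=> sI cI xI ixI; rewrite inE gtn_eqF // -cI.
have := mrank_indep ixI (setUS _ sI).
by rewrite cardsU1 xI.
Qed.

Lemma subset_mspan (T : finType) (M : matroid T) (S : {set T}) :
  S \subset mspan M S.
Proof.
by apply/subsetP => x xS; rewrite inE (setUidPr _) ?sub1set.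
Qed.

Lemma mrank_mspan (T : finType) (M : matroid T) (S : {set T}) :
  mrank M (mspan M S) = mrank M S.
Proof.
apply/eqP; rewrite eqn_leq (mrankS M (subset_mspan M S)) andbT leqNgt.
apply/negP; have [I [iI sI cI]] := mrank_basis M S.
have [J [iJ sJ <-]] := mrank_basis M (mspan M S); rewrite -cI => ltIJ.
have [x] := indep_aug iI iJ ltIJ; rewrite inE => /andP[xI xJ] ixI.
by have := notin_mspan_basis sI cI xI ixI; rewrite (subsetP sJ).
Qed.

Lemma mrank_mspan0 (T : finType) (M : matroid T) (A : {set T}) :
  A \subset mspan M set0 -> mrank M A = 0%N.
Proof. by move/(mrankS M); rewrite mrank_mspan mrank0 leqn0 => /eqP. Qed.

(** Extend a basis of [A] to a basis [K] of [B]. If [x] raised the rank of [B], augmentation would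
    add [x] itself to [K], hence also to the basis of [A], against [x \in mspan M A]. *)
Lemma mspanS (T : finType) (M : matroid T) (A B : {set T}) :
  A \subset B -> mspan M A \subset mspan M B.
Proof.
move=> sAB; apply/subsetP => x xA; rewrite inE.
rewrite eqn_leq (mrankS M (subsetUr _ _)) andbT leqNgt; apply/negP.
have [J [iJ sJ cJ]] := mrank_basis M A.
have [K [iK sJK sK cK]] := indep_extend iJ (subset_trans sJ sAB).
have [I [iI sI <-]] := mrank_basis M (x |: B).
rewrite -cK => ltKI; have [y] := indep_aug iK iI ltKI.
rewrite inE => /andP[yK yI] iyK.
have yx : y = x \/ y \in B.
  by have := subsetP sI y yI; rewrite !inE => /orP[/eqP|]; [left|right].
case: yx => [yx|yB].
  rewrite {}yx in yK iyK.
  have xJ : x \notin J by apply: contra yK; apply: subsetP.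
  have ixJ : x |: J \in indep M by apply: indepS iyK; apply: setUS.
  by have := notin_mspan_basis sJ cJ xJ ixJ; rewrite xA.
have := mrank_indep iyK (S := B).
by rewrite subUset sub1set yB sK -cK cardsU1 yK ltnn => /(_ isT).
Qed.

(** * Chains of nonempty subsets and alternating sums *)

Definition chain (T : finType) (C : {set {set T}}) : bool :=
  (set0 \notin C) &&
  [forall A in C, forall B in C, (A \subset B) || (B \subset A)].

Lemma chainP (T : finType) (C : {set {set T}}) :
  reflect
    (set0 \notin C /\
     {in C &, forall A B : {set T}, (A \subset B) || (B \subset A)})
    (chain C).
Proof.
apply: (iffP andP) => -[C0 tot]; split=> //.
  by move=> A B AinC BinC; exact: (forall_inP (forall_inP tot A AinC) B BinC).
by apply/forall_inP => A AinC; apply/forall_inP => B BinC; exact: tot.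
Qed.

Lemma chain_sub (T : finType) (C D : {set {set T}}) :
  D \subset C -> chain C -> chain D.
Proof.
move=> /subsetP sDC /chainP[C0 tot]; apply/chainP; split.
  by apply: contra C0; exact: sDC.
by move=> A B /sDC AinC /sDC; exact: tot.
Qed.

(** A member of maximal cardinality contains all others. So [cover] is the top of a nonempty chain,
    and the value [set0], which no chain contains, marks the empty one. *)
Lemma chain_cover (T : finType) (C : {set {set T}}) :
  chain C -> C != set0 -> cover C \in C.
Proof.
move=> /chainP[_ tot] /set0Pn[A0 A0C].
case: (arg_maxnP (fun A : {set T} => #|A|) A0C) => A /= AinC maxA.
suff -> : cover C = A by [].
apply/eqP; rewrite eqEsubset [A \subset _]bigcup_sup // andbT.
apply/bigcupsP => B BinC; case/orP: (tot A B AinC BinC) => // sAB.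
have /eqP -> : A == B by rewrite eqEcard sAB; exact: maxA.
exact: subxx.
Qed.

Lemma sum_chain0 (T : finType) (F : {set {set T}} -> int) :
  \sum_(C | chain C && (cover C == set0)) F C = F set0.
Proof.
apply: big_pred1 => C; apply/andP/eqP => [[cC /eqP C0]|->].
  apply: contraTeq cC => nC; apply/negP => cC.
  have := chain_cover cC nC; rewrite C0.
  by case/chainP: cC => /negPf ->.
split; last by rewrite /cover big_set0.
by apply/chainP; split=> [|A B]; rewrite inE.
Qed.

(* The nonempty chains with union S are the S |: C, for C a possibly empty
   chain whose union is a proper subset of S. *)
Lemma sum_chain_rec (T : finType) (F : {set {set T}} -> int) (S : {set T}) :
  S != set0 ->
  \sum_(C | chain C && (cover C == S)) (-1) ^+ #|C| * F C =
  - \sum_(A : {set T} | A \proper S)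
      \sum_(C | chain C && (cover C == A)) (-1) ^+ #|C| * F (S |: C).
Proof.
move=> S0.
have memS C : chain C -> cover C = S -> S \in C.
  move=> cC cS; rewrite -{1}cS chain_cover //.
  by apply: contraNneq S0 => C0; rewrite -cS C0 /cover big_set0.
(* Group the chains by the union [A] of what remains without [S]: the second largest member, or
   [set0] for [C = [set S]]. *)
rewrite (partition_big (fun C => cover (C :\ S)) (fun A => A \proper S));
  last first.
  move=> C /andP[cC /eqP cS]; rewrite properEneq andbC.
  apply/andP; split.
    by apply/bigcupsP => A /setD1P[_ inA]; rewrite -cS [A \subset _]bigcup_sup.
  have cCS := chain_sub (subsetDl C [set S]) cC.
  have [->|nC] := eqVneq (C :\ S) set0.
    by rewrite /cover big_set0 eq_sym.
  by have := chain_cover cCS nC; rewrite !inE => /andP[].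
rewrite -sumrN; apply: eq_bigr => A pA; rewrite -sumrN.
have notS C : cover C = A -> S \notin C.
  move=> cA; apply: contraTN pA => SC; rewrite properE negb_and negbK orbC.
  by rewrite -cA [S \subset _]bigcup_sup.
rewrite (reindex_onto (fun C => S |: C) (fun C => C :\ S)); last first.
  by move=> C /andP[/andP[cC /eqP cS] _]; rewrite setD1K // memS.
apply: eq_big => [C|C /andP[/andP[_ cA] /eqP CS]].
  apply/idP/idP => [/andP[/andP[/andP[cC _] cA] /eqP CS]|/andP[cC /eqP cA]].
    by rewrite CS in cA; rewrite cA andbT (chain_sub _ cC) ?subsetUr.
  have -> : (S |: C) :\ S = C by rewrite setU1K // notS.
  rewrite cA !eqxx !andbT.
  have sCS B : B \in C -> B \subset S.
    move=> BinC; apply: subset_trans (proper_sub pA).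
    by rewrite -cA [B \subset _]bigcup_sup.
  apply/andP; split; last first.
    rewrite /cover bigcup_setU big_set1 [X in _ :|: X]cA.
    exact/eqP/setUidPl/proper_sub.
  case/chainP: cC => C0 tot; apply/chainP; split.
    by rewrite !inE negb_or eq_sym S0.
  move=> B D; rewrite !inE => /orP[/eqP->|BinC] /orP[/eqP->|DinC].
  - by rewrite subxx.
  - by rewrite sCS // orbT.
  - by rewrite sCS.
  - exact: tot.
rewrite CS in cA; rewrite cardsU1 notS ?(eqP cA) //.
by rewrite exprS -!mulrA mulN1r.
Qed.

(** Inserting or removing [x] is an involution that preserves [P] and [F] and flips the sign, so the
    sum is its own opposite. *)
Lemma sum_toggle0 (T : finType) (x : T) (P : pred {set T})
    (F : {set T} -> int) :
  (forall A, P (x |: A) = P (A :\ x)) -> (forall A, F (x |: A) = F (A :\ x)) ->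
  \sum_(A | P A) (-1) ^+ #|A| * F A = 0.
Proof.
move=> Px Fx.
pose t (A : {set T}) := if x \in A then A :\ x else x |: A.
have tK : involutive t.
  move=> A; rewrite /t; have [xA|xA] := boolP (x \in A).
    by rewrite setD11 setD1K.
  by rewrite setU11 setU1K.
have inv (V : Type) (G : {set T} -> V) :
    (forall A, G (x |: A) = G (A :\ x)) -> forall A, G (t A) = G A.
  move=> Gx A; rewrite /t; have [xA|xA] := boolP (x \in A).
    by rewrite -Gx (setUidPr _) ?sub1set.
  by rewrite Gx (setDidPl _) // disjoint_sym disjoints1.
set s := LHS; suff : s = - s by lia.
rewrite {1}/s (reindex_inj (inv_inj tK)) -sumrN.
apply: eq_big => [A|A _]; first exact: inv.
rewrite (inv _ _ Fx) -mulNr; congr (_ * _).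
rewrite /t; have [xA|xA] := boolP (x \in A).
  by rewrite [in RHS](cardsD1 x) xA add1n exprS mulN1r opprK.
by rewrite cardsU1 xA add1n exprS mulN1r.
Qed.

Lemma subset_toggle (T : finType) (x : T) (A P : {set T}) :
  x \in P -> (x |: A \subset P) = (A :\ x \subset P).
Proof.
by move=> xP; rewrite subDset subUset sub1set xP (setUidPr _) ?sub1set.
Qed.

Lemma sum_proper (T : finType) (F : {set T} -> int) (S : {set T}) :
  \sum_(A : {set T} | A \proper S) F A =
  \sum_(A : {set T} | A \subset S) F A - F S.
Proof.
rewrite [X in _ = X - _](bigD1 S) //= addrAC subrr add0r.
by apply: eq_bigl => A; rewrite properEneq andbC.
Qed.

(** * Partial sums of the character *)

Definition usum (m : nat) (u : 'rV[int]_m) (S : {set 'I_m}) : int :=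
  \sum_(i in S) u 0 i.

Definition nonpos (m : nat) (u : 'rV[int]_m) : {set 'I_m} :=
  [set i | u 0 i <= 0].

Lemma usum_nonpos (m : nat) (u : 'rV[int]_m) (S : {set 'I_m}) :
  S \subset nonpos u -> usum u S <= 0.
Proof. by move=> /subsetP sS; apply: sumr_le0 => i /sS; rewrite inE. Qed.

Lemma gt0_disjoint_nonpos (m : nat) (u : 'rV[int]_m) (S : {set 'I_m})
    (j : 'I_m) :
  S :&: nonpos u = set0 -> j \in S -> 0 < u 0 j.
Proof.
move=> SN jS; rewrite ltNge; apply/negP => uj.
by move/setP/(_ j): SN; rewrite !inE jS uj.
Qed.

Lemma usum_gt0 (m : nat) (u : 'rV[int]_m) (S : {set 'I_m}) :
  S != set0 -> S :&: nonpos u = set0 -> 0 < usum u S.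
Proof.
move=> /set0Pn[i iS] SN; have pos := gt0_disjoint_nonpos SN.
rewrite /usum (bigD1 i) //= ltr_pwDl ?pos // sumr_ge0 // => j /andP[jS _].
exact/ltW/pos.
Qed.

(* Corrects the recursion for [chain_rank] at [usum u S = 1]: on the chains with
   [usum u <= 0] the sections are [setT], and adding S cuts them down to
   [mspan M S]. *)
Lemma sum_chain_le0 (m : nat) (u : 'rV[int]_m) (S : {set 'I_m}) :
  \sum_(C | chain C && (cover C == S))
    (-1) ^+ #|C| * ([forall A in C, usum u A <= 0] : nat)%:Z =
  (-1) ^+ #|S| * ((S \subset nonpos u) : nat)%:Z.
Proof.
have [n] := ubnP #|S|; elim: n S => // n IHn S leSn.
have [->|S0] := eqVneq S set0.
  rewrite sum_chain0 !cards0 sub0set.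
  by case: forall_inP => // -[A]; rewrite inE.
rewrite sum_chain_rec //.
have -> : \sum_(A : {set 'I_m} | A \proper S)
    \sum_(C | chain C && (cover C == A)) (-1) ^+ #|C| *
      ([forall B in S |: C, usum u B <= 0] : nat)%:Z =
    ((usum u S <= 0)%R : nat)%:Z * \sum_(A : {set 'I_m} | A \proper S)
      (-1) ^+ #|A| * ((A \subset nonpos u) : nat)%:Z.
  rewrite big_distrr; apply: eq_bigr => A pA /=.
  rewrite -IHn; last by apply: leq_trans (proper_card pA) _.
  rewrite big_distrr; apply: eq_bigr => C _ /=.
  rewrite mulrCA; congr (_ * _).
  have -> : [forall B in S |: C, usum u B <= 0] =
      (usum u S <= 0) && [forall B in C, usum u B <= 0].
    apply/forall_inP/andP => [SC|[leS /forall_inP leC] B].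
      split; first by apply: SC; rewrite setU11.
      by apply/forall_inP => B BC'; apply: SC; rewrite setU1r.
    by rewrite !inE => /orP[/eqP->|/leC].
  by rewrite -mulnb PoszM.
rewrite sum_proper.
have [leS|gtS] := leP (usum u S) 0; last first.
  rewrite mul0r oppr0; case: (boolP (S \subset nonpos u)) => [|_].
    by move/usum_nonpos; rewrite leNgt gtS.
  by rewrite mulr0.
(* A nonempty [S] with [usum u S <= 0] meets [nonpos u]. Toggling a common element cancels the sum
   over all subsets and leaves the term of [S]. *)
have [SN|[x]] := set_0Vmem (S :&: nonpos u).
  by move: leS; rewrite leNgt usum_gt0.
rewrite inE => /andP[xS xN]; rewrite (@sum_toggle0 _ x).
- by rewrite mul1r sub0r opprK.
- by move=> A; rewrite subset_toggle.
- by move=> A; rewrite subset_toggle.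
Qed.

(** The entries on [S] are integers at least 1, so two of them would already exceed the total. *)
Lemma usum1_singleton (m : nat) (u : 'rV[int]_m) (S : {set 'I_m}) :
  S :&: nonpos u = set0 -> usum u S = 1 ->
  exists i, S = [set i] /\ u 0 i = 1.
Proof.
move=> SN uS.
have pos := gt0_disjoint_nonpos SN.
have [S0|[i iS]] := set_0Vmem S.
  by move: uS; rewrite /usum S0 big_set0.
exists i; have Si : S = [set i].
  apply/eqP; rewrite eqEsubset [_ \subset S]sub1set iS andbT.
  apply/subsetP => j jS; rewrite inE; apply: contraT => ji.
  move: uS; rewrite /usum (bigD1 i) //= (bigD1 j) /=; last by rewrite jS.
  have := pos i iS; have := pos j jS.
  set s := (X in _ + (_ + X)); have : 0 <= s.
    by apply: sumr_ge0 => k /andP[/andP[kS _] _]; apply/ltW/pos.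
  lia.
by split=> //; rewrite -uS /usum Si big_set1.
Qed.

(** * Ranks of sections summed over chains *)

Definition chain_rank (m : nat) (M : matroid 'I_m) (u : 'rV[int]_m)
    (C : {set {set 'I_m}}) : int :=
  (mrank M (\bigcap_(S in C) filt M S (usum u S)))%:Z.

(** At most one summand survives: the full rank if [u] is nonpositive on [S], or [mrank M [set i]]
    if the only positive entry on [S] is a 1 at [i]. *)
Definition closed_form (m : nat) (M : matroid 'I_m) (u : 'rV[int]_m)
    (S : {set 'I_m}) : int :=
  (mrank M setT)%:Z * ((S \subset nonpos u) : nat)%:Z +
  \sum_(i in S | u 0 i == 1)
     (mrank M [set i])%:Z * ((S :\ i \subset nonpos u) : nat)%:Z.

Lemma closed_form_toggle (m : nat) (M : matroid 'I_m) (u : 'rV[int]_m)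
    (x : 'I_m) (A : {set 'I_m}) : x \in nonpos u ->
  closed_form M u (x |: A) = closed_form M u (A :\ x).
Proof.
move=> xN; rewrite /closed_form subset_toggle //; congr (_ + _).
apply: eq_big => [i|i /andP[_ /eqP ui]].
  rewrite !inE; have [->|//] := eqVneq i x.
  by case: eqP => [ux|]; rewrite ?andbF //; rewrite inE ux in xN.
have ix : i != x by apply: contraTneq xN => <-; rewrite inE ui.
congr (_ * (nat_of_bool _)%:Z).
have -> : (x |: A) :\ i = x |: (A :\ i).
  apply/setP => j; rewrite !inE.
  by have [->|] := eqVneq j x; rewrite // eq_sym ix.
by rewrite subset_toggle // !setDDl setUC.
Qed.

Lemma closed_form0 (m : nat) (M : matroid 'I_m) (u : 'rV[int]_m) :
  closed_form M u set0 = (mrank M setT)%:Z.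
Proof.
by rewrite /closed_form sub0set mulr1 big1 ?addr0 // => i; rewrite inE.
Qed.

Lemma closed_form_ge2 (m : nat) (M : matroid 'I_m) (u : 'rV[int]_m)
    (S : {set 'I_m}) : 1 < usum u S -> closed_form M u S = 0.
Proof.
move=> uS; rewrite /closed_form big1 => [|i /andP[iS /eqP ui]].
  case: (boolP (S \subset _)) => [/usum_nonpos uN|_]; last by rewrite mulr0.
  by move: uS; rewrite ltNge (le_trans uN).
case: (boolP (_ \subset _)) => [/usum_nonpos uN|_]; last by rewrite mulr0.
by move: uS; rewrite /usum (big_setD1 i) //= ui ltrDl ltNge uN.
Qed.

Lemma chain_rank_ge2 (m : nat) (M : matroid 'I_m) (u : 'rV[int]_m)
    (C : {set {set 'I_m}}) (S : {set 'I_m}) :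
  S \in C -> 1 < usum u S -> chain_rank M u C = 0.
Proof.
move=> SC uS; rewrite /chain_rank mrank_mspan0 //.
apply: (subset_trans (bigcap_inf S SC)).
by rewrite /filt leNgt (lt_trans ltr01 uS) gt_eqF.
Qed.

Lemma chain_rank_le0 (m : nat) (M : matroid 'I_m) (u : 'rV[int]_m)
    (C : {set {set 'I_m}}) (S : {set 'I_m}) :
  usum u S <= 0 -> chain_rank M u (S |: C) = chain_rank M u C.
Proof.
move=> uS; rewrite /chain_rank bigcap_setU big_set1.
by rewrite {1}/filt uS setTI.
Qed.

(** If some [A] in [C] has [usum u A > 0], the sections already lie in [mspan M A], inside
    [mspan M S], and [S] changes nothing. Otherwise they drop from [setT] to [mspan M S]. *)
Lemma chain_rank_eq1 (m : nat) (M : matroid 'I_m) (u : 'rV[int]_m)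
    (C : {set {set 'I_m}}) (S : {set 'I_m}) :
  cover C \subset S -> usum u S = 1 ->
  chain_rank M u (S |: C) = chain_rank M u C -
    ([forall A in C, usum u A <= 0] : nat)%:Z *
    ((mrank M setT)%:Z - (mrank M S)%:Z).
Proof.
move=> sCS uS; rewrite /chain_rank bigcap_setU big_set1.
rewrite {1}/filt uS /=; case: forall_inP => [leC|gtC].
  have -> : \bigcap_(A in C) filt M A (usum u A) = setT.
    by apply: big1 => A /leC uA; rewrite /filt uA.
  by rewrite setIT mrank_mspan mul1r opprB addrC subrK.
rewrite mul0r subr0; congr (mrank M _)%:Z; apply/setIidPr.
have /exists_inP[A inA uA] : [exists A in C, ~~ (usum u A <= 0)].
  by rewrite -negb_forall_in; apply/forall_inP.
apply: (subset_trans (bigcap_inf A inA)); rewrite /filt (negPf uA).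
have sAS : A \subset S by apply: subset_trans sCS; exact: bigcup_sup.
by case: ifP => _; rewrite ?mspan0S ?mspanS.
Qed.

(** Induction on [#|S|]. Adding [S] to a chain makes the rank 0, keeps it, or corrects it, according
    as [usum u S] is above 1, at most 0, or equal to 1. *)
Lemma sum_chain_rank (m : nat) (M : matroid 'I_m) (u : 'rV[int]_m)
    (S : {set 'I_m}) :
  \sum_(C | chain C && (cover C == S)) (-1) ^+ #|C| * chain_rank M u C =
  (-1) ^+ #|S| * closed_form M u S.
Proof.
have [n] := ubnP #|S|; elim: n S => // n IHn S leSn.
have [->|S0] := eqVneq S set0.
  by rewrite sum_chain0 /chain_rank closed_form0 big_set0 !cards0.
rewrite sum_chain_rec //.
have IH : \sum_(A : {set 'I_m} | A \proper S)
    \sum_(C | chain C && (cover C == A)) (-1) ^+ #|C| * chain_rank M u C =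
    \sum_(A : {set 'I_m} | A \proper S) (-1) ^+ #|A| * closed_form M u A.
  by apply: eq_bigr => A pA; apply: IHn; apply: leq_trans (proper_card pA) _.
have [gt1|le1] := ltP 1 (usum u S).
  rewrite closed_form_ge2 // mulr0 big1 ?oppr0 // => A _; apply: big1 => C _.
  by rewrite (@chain_rank_ge2 _ _ _ _ S) ?mulr0 // setU11.
have sum0 x : x \in S :&: nonpos u -> \sum_(A : {set 'I_m} | A \subset S)
      (-1) ^+ #|A| * closed_form M u A = 0.
  rewrite inE => /andP[xS xN].
  apply: (@sum_toggle0 _ x) => A; first by rewrite subset_toggle.
  exact: closed_form_toggle.
have [leS|gtS] := leP (usum u S) 0.
  have [SN|[x xSN]] := set_0Vmem (S :&: nonpos u).
    by move: leS; rewrite leNgt usum_gt0.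
  under eq_bigr => A _ do under eq_bigr => C _ do rewrite chain_rank_le0 //.
  by rewrite IH sum_proper (sum0 _ xSN) // sub0r opprK.
have uS : usum u S = 1 by lia.
set d := (mrank M setT)%:Z - (mrank M S)%:Z.
have -> : \sum_(A : {set 'I_m} | A \proper S)
    \sum_(C | chain C && (cover C == A)) (-1) ^+ #|C| *
      chain_rank M u (S |: C) =
    \sum_(A : {set 'I_m} | A \proper S)
      ((-1) ^+ #|A| * closed_form M u A -
       (-1) ^+ #|A| * ((A \subset nonpos u) : nat)%:Z * d).
  rewrite sumrB -IH -sumrB; apply: eq_bigr => A pA.
  rewrite -sum_chain_le0 mulr_suml -sumrB; apply: eq_bigr => C /andP[_ /eqP cA].
  rewrite chain_rank_eq1 ?cA ?proper_sub // mulrBr; congr (_ - _).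
  by rewrite mulrA.
(* When [S] misses [nonpos u] it is a singleton, and [set0] is its only proper subset. *)
have [SN|[x xSN]] := set_0Vmem (S :&: nonpos u).
  have [i [Si ui]] := usum1_singleton SN uS.
  rewrite (big_pred1 set0) => [|A]; last first.
    rewrite Si properEcard cards1 ltnS leqn0 cards_eq0 andbC /=.
    by case: eqVneq => // ->; rewrite sub0set.
  have iN : i \notin nonpos u by rewrite inE ui.
  rewrite cards0 closed_form0 sub0set /closed_form Si cards1 sub1set (negPf iN).
  rewrite (big_pred1 i) => [|j]; last first.
    by rewrite inE /=; case: (eqVneq j i) => [->|]; rewrite ?ui.
  rewrite setDv sub0set /d Si; lia.
have xN : x \in nonpos u by case/setIP: xSN.
have xS : x \in S by case/setIP: xSN.
(* Toggling [x] cancels both sums over all subsets. The correction has no term at [S] either, since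
   [usum u S = 1] excludes [S \subset nonpos u]. *)
rewrite sumrB -mulr_suml !sum_proper (sum0 _ xSN) // (@sum_toggle0 _ x).
- case: (boolP (S \subset nonpos u)) => [/usum_nonpos|_].
    by rewrite leNgt gtS.
  by rewrite mulr0 subr0 mul0r subr0 sub0r opprK.
- by move=> A; rewrite subset_toggle.
- by move=> A; rewrite subset_toggle.
Qed.

(** * Global sections *)

Lemma h0_closed_form (m : nat) (M : matroid 'I_m) (u : 'rV[int]_m) :
  \sum_i u 0 i = 1 -> (h0 M u)%:Z = closed_form M u setT.
Proof.
move=> u1; rewrite /h0 sections_sum1 //.
pose P := ~: nonpos u.
have uT : usum u setT = 1 by rewrite -u1; apply: eq_bigl => i; rewrite inE.
have uPN : usum u P + usum u (nonpos u) = 1.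
  rewrite -uT /usum [RHS](big_setID P) /= setTI; congr (_ + _).
  by apply: eq_bigl => i; rewrite /P !inE andbT negbK.
have PN : P :&: nonpos u = set0 by rewrite setIC setICr.
have N0 := usum_nonpos (subxx (nonpos u)).
have P0 : P != set0.
  apply: contraTneq N0 => P0; move: uPN.
  by rewrite P0 /usum big_set0 add0r => ->.
(* If [usum u P > 1], the condition at [P] alone forces rank 0. The closed form vanishes too, as it
   could survive only for [P] empty or a singleton with entry 1. *)
have [gt1|le1] := ltP 1 (usum u P).
  rewrite mrank_mspan0; last first.
    apply: (subset_trans (bigcap_inf P _)); first by rewrite inE.
    rewrite -/(usum u P) /filt leNgt (lt_trans ltr01 gt1) /=.
    by rewrite gt_eqF.
  rewrite /closed_form subTset big1 => [|i /andP[_ /eqP ui]].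
    case: eqP => [NT|_]; last by rewrite mulr0 addr0.
    by move: N0; rewrite NT uT.
  have iP : i \in P by rewrite !inE ui.
  case: (boolP (_ \subset _)) => [/subsetP sN|_]; last by rewrite mulr0.
  have Pi : P = [set i].
    apply/eqP; rewrite eqEsubset [_ \subset P]sub1set iP andbT.
    apply/subsetP => j; rewrite in_setC in_set1; apply: contraNT => ji.
    by apply: sN; rewrite !inE ji.
  by move: gt1; rewrite Pi /usum big_set1 ui.
(* The remaining case is [u = e_i]: [P] is a singleton, and the nonpositive entries sum to 0, so
   each is 0. *)
have uP : usum u P = 1 by have := usum_gt0 P0 PN; lia.
have [i [Pi ui]] := usum1_singleton PN uP.
have uN0 : usum u (nonpos u) = 0 by lia.
have u0 j : j != i -> u 0 j = 0.
  move=> ji; have jN : j \in nonpos u.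
    by apply: contraNT ji; rewrite -in_setC -/P Pi inE.
  move: uN0; rewrite /usum (bigD1 j) //=.
  set s := (X in _ + X); have : s <= 0.
    by apply: sumr_le0 => k /andP[]; rewrite inE.
  by move: jN; rewrite inE; lia.
have uS S : \sum_(k in S) u 0 k = ((i \in S) : nat)%:Z.
  have [iS|iS] := boolP (i \in S).
    by rewrite (bigD1 i) //= big1 ?addr0 // => k /andP[_ /u0].
  by rewrite big1 // => k kS; apply: u0; apply: contraNneq iS => <-.
have -> : \bigcap_(S in [set S | S != set0]) filt M S (\sum_(k in S) u 0 k) =
    mspan M [set i].
  (* The upper bound is the condition at [[set i]]. Any other [S] imposes the larger [mspan M S] if
     it contains [i], and [setT] if not. *)
  apply/eqP; rewrite eqEsubset; apply/andP; split.
    apply: (subset_trans (bigcap_inf [set i] _)); last by rewrite uS set11.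
    by rewrite inE; apply/set0Pn; exists i; rewrite set11.
  apply/bigcapsP => S _; rewrite uS /filt; case: (boolP (i \in S)) => iS /=.
    by rewrite mspanS // sub1set.
  exact: subsetT.
rewrite mrank_mspan /closed_form subTset.
have iN : i \notin nonpos u by rewrite inE ui.
rewrite (big_pred1 i) => [|j]; last first.
  by rewrite inE /=; case: (eqVneq j i) => [->|/u0 ->]; rewrite ?ui.
case: eqP => [NT|_]; first by rewrite NT inE in iN.
case: (boolP (_ \subset _)) => [_|/subsetPn[j]].
  by rewrite mulr0 mulr1 add0r.
by rewrite !inE andbT => /u0 ->; rewrite lexx.
Qed.

(** * The Euler characteristic as a sum over chains with union [setT] *)

Unset Implicit Arguments.

Theorem theorem1p4 (m : nat) (M : matroid 'I_m) (u : 'rV[int]_m) :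
  euler_char M u = (h0 M u)%:Z.
Proof.
have [u1|u1] := eqVneq (\sum_i u 0 i) 1; last first.
  rewrite /euler_char big1 => [|C /and3P[_ TC _]]; last first.
    by rewrite /h0_cone sections_sum_neq1 // mrank_mspan0 ?mulr0.
  (* For [m = 0] the family of nonempty sets does not contain [setT], so this case is settled
     apart. *)
  have [T0|TN0] := eqVneq [set: 'I_m] set0.
    by rewrite /h0 mrank_mspan0 // (subset_trans (subsetT _)) // T0 sub0set.
  by rewrite /h0 sections_sum_neq1 ?inE // mrank_mspan0.
have T0 : [set: 'I_m] != set0.
  apply: contra_eq_neq u1 => T0; rewrite big1 // => i _.
  by move/setP/(_ i): T0; rewrite !inE.
rewrite h0_closed_form //.
have flagE (C : {set {set 'I_m}}) : flag C = chain C && (cover C == setT).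
  apply/and3P/andP => [[C0 TC tot]|[cC /eqP cT]].
    split; first exact/andP.
    by rewrite eqEsubset subsetT [setT \subset _]bigcup_sup.
  have TC : setT \in C.
    rewrite -cT chain_cover //; apply: contraNneq T0 => C0.
    by rewrite -cT C0 /cover big_set0.
  by case/andP: cC.
(* The subtraction in [codim] is truncated; [flag_card_leq] supplies the bound. *)
have signB n : (n <= m)%N -> (-1) ^+ (m - n) = (-1) ^+ m * (-1) ^+ n :> int.
  by move=> le_nm; rewrite -signr_odd oddB // signr_addb !signr_odd.
have -> : euler_char M u =
    (-1) ^+ m * \sum_(C | chain C && (cover C == setT))
                  (-1) ^+ #|C| * chain_rank M u C.
  rewrite big_distrr /euler_char (eq_bigl _ _ flagE); apply: eq_bigr => C.
  rewrite -flagE => fC; rewrite /codim signB ?flag_card_leq // -mulrA.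
  by rewrite /h0_cone sections_sum1.
by rewrite sum_chain_rank cardsT card_ord mulrA -expr2 sqrr_sign mul1r.
Qed.
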